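(* Let $(\mathcal H_t)_{t>0}$ be the Ornstein--Uhlenbeck semigroup on $\mathbb R^n$ determined by $Q$ and $B$, and write $L^p(dx)$ and $L^{p,\infty}(dx)$ for the Lebesgue and weak Lebesgue spaces on $\mathbb R^n$ with respect to Lebesgue measure. Let $1\le\varrho<\infty$ and $1\le p<\infty$. Then the maximal, variational and jump operators and the oscillation associated with $(\mathcal H_t)_{t>0}$ are neither strongly nor weakly bounded on $L^p(dx)$. Explicitly, for $X=L^p(dx)$ and also for $X=L^{p,\infty}(dx)$, there is no constant $C<\infty$ for which any one of the following inequalities holds for all $f\in L^p(dx)$: (i) $\|\mathcal H_*f\|_X\le C\|f\|_{L^p(dx)}$; (ii) $\big\|\,\|\mathcal H_tf(\cdot)\|_{v(\varrho),\mathbb R_+}\big\|_X\le C\|f\|_{L^p(dx)}$; (iii) $\sup_{\lambda>0}\big\|\lambda\,\big(N_\lambda(\mathcal H_tf(\cdot):t>0)\big)^{1/\varrho}\big\|_X\le C\|f\|_{L^p(dx)}$; (iv) $\sup_{N\ge1}\sup_{\{t_i\}}\big\|\mathcal O^\varrho_{\{t_i\},N}(\mathcal H_tf:t>0)\big\|_X\le C\|f\|_{L^p(dx)}$, with the inner supremum over all increasing sequences $(t_i)_0^N$ in $\mathbb R_+$.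
   Context: Fix $n\ge 1$, a real symmetric positive definite $n\times n$ matrix $Q$, and a real $n\times n$ matrix $B$ all of whose eigenvalues have negative real parts. For $t\in(0,+\infty]$ let $Q_t=\int_0^t e^{sB}Qe^{sB^*}\,ds$ and let $\gamma_t$ be the Gaussian probability measure $d\gamma_t(x)=(2\pi)^{-n/2}(\det Q_t)^{-1/2}e^{-\frac12\langle Q_t^{-1}x,x\rangle}\,dx$. The Ornstein--Uhlenbeck semigroup is $\mathcal H_t f(x)=\int_{\mathbb R^n} f(e^{tB}x-y)\,d\gamma_t(y)$ for $t>0$, $x\in\mathbb R^n$, $f\in L^1(\gamma_\infty)$ (note $L^p(dx)\subset L^1(\gamma_\infty)$). $\mathbb R_+=(0,\infty)$. Maximal operator: $\mathcal H_*f(x)=\sup_{t>0}\mathcal H_tf(x)$. Variation seminorm of order $\varrho$: $\|\mathcal H_tf(x)\|_{v(\varrho),\mathbb R_+}=\sup\big(\sum_{i=1}^N|\mathcal H_{t_i}f(x)-\mathcal H_{t_{i-1}}f(x)|^\varrho\big)^{1/\varrho}$, the supremum being over all finite increasing sequences $(t_i)_0^N$, $N\ge1$, in $\mathbb R_+$. Jump counting function: $N_\lambda(\mathcal H_tf(x):t>0)$ is the supremum of all $N\in\{1,2,\dots\}$ for which there exist $0<t_0<\dots<t_N$ with $|\mathcal H_{t_i}f(x)-\mathcal H_{t_{i-1}}f(x)|>\lambda$ for $i=1,\dots,N$ (and $0$ if there is no such $N$). Oscillation of order $\varrho$ for an increasing sequence $(t_i)_0^N$ in $\mathbb R_+$: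 $\mathcal O^\varrho_{\{t_i\},N}(\mathcal H_tf(x):t>0)=\big(\sum_{i=1}^N\sup_{t_{i-1}\le t\le t_i}|\mathcal H_tf(x)-\mathcal H_{t_i}f(x)|^\varrho\big)^{1/\varrho}$. $\|g\|_{L^{p,\infty}(dx)}=\sup_{\alpha>0}\alpha\,|\{x:|g(x)|>\alpha\}|^{1/p}$. *)

(* Defs.v *)
From HB Require Import structures.
From mathcomp Require Import all_boot all_order all_algebra.
From mathcomp Require Import all_classical all_reals all_analysis.
From mathcomp Require Import measurable_realfun.
From mathcomp Require Import complex.

Set Implicit Arguments.
Unset Strict Implicit.
Unset Printing Implicit Defensive.

Import Order.TTheory GRing.Theory Num.Theory.
Import numFieldNormedType.Exports.

Local Open Scope classical_set_scope.
Local Open Scope ring_scope.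

(* R^n is 'cV[R]_n, with the sigma-algebra generated by the coordinates, that
   is, the Borel sigma-algebra. *)
Definition cV_display : measure_display.
Proof. exact: default_measure_display. Qed.

Definition cV_coord (R : realType) n (i : 'I_n) (x : 'cV[R]_n) : R := x i ord0.

Section measurable_cV.
Context (R : realType) (n : nat).

Let cV_set0 : g_sigma_preimage (@cV_coord R n) set0.
Proof. exact: sigma_algebra0. Qed.

Let cV_setC A :
  g_sigma_preimage (@cV_coord R n) A -> g_sigma_preimage (@cV_coord R n) (~` A).
Proof. exact: sigma_algebraC. Qed.

Let cV_bigcup (F : (set 'cV[R]_n)^nat) :
  (forall i, g_sigma_preimage (@cV_coord R n) (F i)) ->
  g_sigma_preimage (@cV_coord R n) (\bigcup_i (F i)).
Proof. exact: sigma_algebra_bigcup. Qed.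

HB.instance Definition _ := @isMeasurable.Build cV_display
  'cV[R]_n (g_sigma_preimage (@cV_coord R n)) cV_set0 cV_setC cV_bigcup.

End measurable_cV.

Lemma measurable_cV_coord (R : realType) n (i : 'I_n) :
  measurable_fun [set: 'cV[R]_n] (cV_coord i).
Proof.
move=> _ Y mY; rewrite setTI; apply: sub_sigma_algebra => /=.
rewrite -bigcup_seq/=; exists i => /=; first by rewrite mem_index_enum.
by exists Y => //; rewrite setTI.
Qed.

Lemma measurable_fun_cVP d (T : measurableType d) (R : realType) n
    (f : T -> 'cV[R]_n) :
  (forall i, measurable_fun [set: T] (fun t => f t i ord0)) ->
  measurable_fun [set: T] f.
Proof.
move=> mf; apply: (@measurability _ _ _ _ _ _ (\big[setU/set0]_(i < n)
  preimage_set_system [set: 'cV[R]_n] (cV_coord i) measurable) erefl).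
move=> _ [B + <-]; rewrite -bigcup_seq => -[i _ [A mA <-]] /=.
by rewrite setTI; exact: (mf i measurableT A mA).
Qed.

Section lebesgue_succ.
Context (R : realType) (n : nat).

Definition cons_cV (x : measurableTypeR R * 'cV[R]_n) : 'cV[R]_n.+1 :=
  col_mx (x.1%:M : 'M[R]_1) x.2.

Definition uncons_cV (x : 'cV[R]_n.+1) : measurableTypeR R * 'cV[R]_n :=
  (x ord0 ord0, \col_i x (lift ord0 i) ord0).

Lemma cons_cV0 x : cons_cV x ord0 ord0 = x.1.
Proof.
rewrite /cons_cV (_ : ord0 = lshift n (ord0 : 'I_1)); last exact/val_inj.
by rewrite (@col_mxEu R 1 n 1) mxE eqxx.
Qed.

Lemma cons_cVS x i : cons_cV x (lift ord0 i) ord0 = x.2 i ord0.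
Proof.
rewrite /cons_cV (_ : lift ord0 i = rshift 1 i); last exact/val_inj.
by rewrite (@col_mxEd R 1 n 1).
Qed.

Lemma cons_cVK : cancel cons_cV uncons_cV.
Proof.
move=> [x v]; rewrite /uncons_cV cons_cV0; congr pair.
by apply/colP => i; rewrite mxE cons_cVS.
Qed.

Lemma measurable_cons_cV : measurable_fun [set: _] cons_cV.
Proof.
apply: measurable_fun_cVP => i; have [j ->|->] := unliftP ord0 i.
  under eq_fun do rewrite cons_cVS.
  exact: (measurableT_comp (measurable_cV_coord j) measurable_snd).
under eq_fun do rewrite cons_cV0.
exact: measurable_fst.
Qed.

Lemma measurable_uncons_cV : measurable_fun [set: _] uncons_cV.
Proof.
apply: measurable_fun_pair; first exact: (@measurable_cV_coord R n.+1).
apply: measurable_fun_cVP => i.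
under eq_fun do rewrite mxE.
exact: measurable_cV_coord.
Qed.

Variable m : {sigma_finite_measure set 'cV[R]_n -> \bar R}.

Definition lebesgue_succ : set 'cV[R]_n.+1 -> \bar R :=
  pushforward (lebesgue_measure \x m)%E cons_cV.

Let lebesgue_succ0 : lebesgue_succ set0 = 0%E.
Proof. by rewrite /lebesgue_succ /pushforward preimage_set0 measure0. Qed.

Let lebesgue_succ_ge0 A : (0 <= lebesgue_succ A)%E.
Proof. by rewrite /lebesgue_succ /pushforward measure_ge0. Qed.

Let mpre A : measurable A -> measurable (cons_cV @^-1` A).
Proof.
by move=> mA; rewrite -[X in measurable X]setTI; exact: measurable_cons_cV.
Qed.

Let lebesgue_succ_sigma_additive : semi_sigma_additive lebesgue_succ.
Proof.
move=> F mF tF mUF; rewrite /lebesgue_succ /pushforward preimage_bigcup.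
apply: measure_semi_sigma_additive.
- by move=> k; exact: mpre.
- apply/trivIsetP => /= i j _ _ ij; rewrite -preimage_setI.
  by move/trivIsetP : tF => /(_ _ _ _ _ ij) ->//; rewrite preimage_set0.
- by rewrite -preimage_bigcup; exact: mpre.
Qed.

HB.instance Definition _ := isMeasure.Build _ _ _ lebesgue_succ
  lebesgue_succ0 lebesgue_succ_ge0 lebesgue_succ_sigma_additive.

Let lebesgue_succ_sigma_finite : sigma_finite setT lebesgue_succ.
Proof.
have /sigma_finiteP[F [TF ndF Foo]] := sigma_finiteT (@lebesgue_measure R).
have /sigma_finiteP[G [TG ndG Goo]] := sigma_finiteT m.
exists (fun k => uncons_cV @^-1` (F k `*` G k)).
  rewrite -preimage_bigcup (_ : \bigcup_i _ = setT) ?preimage_setT//.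
  rewrite -subTset => -[x y] _.
  have [i _ Fx] : (\bigcup_i F i) x by rewrite -TF.
  have [j _ Gy] : (\bigcup_i G i) y by rewrite -TG.
  exists (maxn i j) => //; split.
  - by move: x Fx; exact/subsetPset/ndF/leq_maxl.
  - by move: y Gy; exact/subsetPset/ndG/leq_maxr.
move=> k; have [? ?] := Foo k; have [? ?] := Goo k; split.
  rewrite -[X in measurable X]setTI; apply: measurable_uncons_cV => //.
  exact: measurableX.
rewrite /lebesgue_succ /pushforward -comp_preimage.
rewrite (_ : uncons_cV \o cons_cV = id); last first.
  by apply/funext; exact: cons_cVK.
by rewrite preimage_id product_measure1E// lte_mul_pinfty// ge0_fin_numE.
Qed.

HB.instance Definition _ := Measure_isSigmaFinite.Build _ _ _ lebesgue_succ
  lebesgue_succ_sigma_finite.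

End lebesgue_succ.

(* Lebesgue measure on R^n; see lebesgue_cV_box for its values on boxes. *)
Fixpoint lebesgue_cV (R : realType) (n : nat) :
    {sigma_finite_measure set 'cV[R]_n -> \bar R} :=
  if n is n'.+1 then lebesgue_succ (lebesgue_cV R n') else \d_(0 : 'cV[R]_0).

Lemma lebesgue_cV_box (R : realType) n
    (A : 'I_n -> set (measurableTypeR R)) :
  (forall i, measurable (A i)) ->
  lebesgue_cV R n [set x | forall i, A i (x i ord0)] =
  (\prod_(i < n) lebesgue_measure (A i))%E.
Proof.
elim: n A => [|n IHn] A mA.
  by rewrite big_ord0 /= diracE mem_set// => -[].
rewrite big_ord_recl -IHn// -product_measure1E//; last first.
  rewrite (_ : (fun _ => _) =
      \bigcap_(i in [set: 'I_n]) cV_coord i @^-1` A (lift ord0 i)).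
    apply: fin_bigcap_measurable => // i _.
    rewrite -[X in measurable X]setTI.
    exact: (measurable_cV_coord i measurableT (mA (lift ord0 i))).
  by apply/seteqP; split => x /= xA i => [_|]; exact: xA.
rewrite /= /lebesgue_succ /pushforward; congr product_measure1.
apply/seteqP; split => [[x v] /= xvA|[x v] [/= xA vA] i /=].
  split; first by have := xvA ord0; rewrite cons_cV0.
  by move=> i; have := xvA (lift ord0 i); rewrite cons_cVS.
by have [j ->|->] := unliftP ord0 i; rewrite ?cons_cVS ?cons_cV0.
Qed.

Definition expmx (R : realType) n (A : 'M[R]_n) : 'M[R]_n :=
  limn (series (fun k => (k`!%:R)^-1 *: A ^+ k)).

Definition posdefmx (R : realType) n (A : 'M[R]_n) : Prop :=
  A^T = A /\ forall x : 'cV[R]_n, x != 0 -> 0 < (x^T *m A *m x) ord0 ord0.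

Section gaussian.
Context (R : realType) (n : nat) (S : 'M[R]_n).

(* The centred Gaussian measure on R^n with covariance matrix S, meant for S
   positive definite. *)
Definition gaussian_pdf (x : 'cV[R]_n) : R :=
  (2 * pi) `^ (- (n%:R / 2)) * (\det S) `^ (- 2^-1) *
  expR (- 2^-1 * ((invmx S *m x)^T *m x) ord0 ord0).

Lemma gaussian_pdf_ge0 x : 0 <= gaussian_pdf x.
Proof. by rewrite !mulr_ge0 ?powR_ge0 ?expR_ge0. Qed.

Lemma measurable_gaussian_pdf : measurable_fun setT gaussian_pdf.
Proof.
apply: measurable_funM => //; apply: measurableT_comp => //.
apply: measurable_funM => //.
under eq_fun do rewrite mxE.
apply: measurable_sum => i; apply: measurable_funM;
  last exact: measurable_cV_coord.
under eq_fun do rewrite !mxE.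
apply: measurable_sum => j; apply: measurable_funM => //.
exact: measurable_cV_coord.
Qed.

Definition gaussian : set 'cV[R]_n -> \bar R :=
  fun A => (\int[lebesgue_cV R n]_(x in A) (gaussian_pdf x)%:E)%E.

Let gaussian0 : gaussian set0 = 0%E.
Proof. exact: integral_set0. Qed.

Let gaussian_ge0 A : (0 <= gaussian A)%E.
Proof. by apply: integral_ge0 => x _; rewrite lee_fin gaussian_pdf_ge0. Qed.

Let gaussian_sigma_additive : semi_sigma_additive gaussian.
Proof.
move=> F mF tF mUF; rewrite /gaussian ge0_integral_bigcup//; last 2 first.
- apply: measurable_funTS; apply: measurableT_comp => //.
  exact: measurable_gaussian_pdf.
- by move=> x _; rewrite lee_fin gaussian_pdf_ge0.
apply: is_cvg_ereal_nneg_natsum_cond => k _ _; exact: gaussian_ge0.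
Qed.

HB.instance Definition _ := isMeasure.Build _ _ _ gaussian
  gaussian0 gaussian_ge0 gaussian_sigma_additive.

End gaussian.

(* ou_cov t is Q_t and gaussian (ou_cov t) is gamma_t, for 0 < t < +oo; ou t f x
   is H_t f (x). For real matrices B^* is the transpose of B. *)
Section ornstein_uhlenbeck.
Context (R : realType) (n : nat) (Q B : 'M[R]_n).

Definition ou_cov (t : R) : 'M[R]_n := \matrix_(i, j)
  \int[lebesgue_measure]_(s in `[0, t])
    (expmx (s *: B) *m Q *m expmx (s *: B^T)) i j.

Definition ou (t : R) (f : 'cV[R]_n -> R) (x : 'cV[R]_n) : R :=
  \int[gaussian (ou_cov t)]_y f (expmx (t *: B) *m x - y).

End ornstein_uhlenbeck.

(* The operators below act on one trajectory a : t |-> a t, restricted to t > 0;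
   they are applied to t |-> H_t f (x) at each point x. *)
Section trajectories.
Context (R : realType).
Implicit Types (a : R -> R) (rho lambda : R) (N : nat) (s : nat -> R).

Definition maximal_function a : \bar R :=
  ereal_sup [set (a t)%:E | t in [set t | 0 < t]].

(* The times s 0 < s 1 < ... < s N. Only s 0, ..., s N matter: the definitions
   below do not use the other values of s. *)
Definition time_seq N : set (nat -> R) :=
  [set s | 0 < s 0%N /\ forall i, (i < N)%N -> s i < s i.+1].

Definition variation_seminorm rho a : \bar R :=
  ereal_sup [set v | exists N s, [/\ (0 < N)%N, time_seq N s &
    v = ((\sum_(i < N) `|a (s i.+1) - a (s i)| `^ rho) `^ rho^-1)%:E]].

Definition jump_count lambda a : \bar R :=
  maxe 0%E (ereal_sup [set N%:R%:E | N in [set N | (0 < N)%N /\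
    exists2 s, time_seq N s &
      forall i, (i < N)%N -> lambda < `|a (s i.+1) - a (s i)|]]).

Definition oscillation rho s N a : \bar R :=
  ((\sum_(i < N) ereal_sup [set (`|a t - a (s i.+1)| `^ rho)%:E |
     t in [set t | (s i <= t <= s i.+1)%R]]) `^ rho^-1)%E.

End trajectories.

Section Lp_spaces.
Context (R : realType) (n : nat) (p : R).
Local Notation mu := (lebesgue_cV R n).
Local Open Scope ereal_scope.

Definition Lp_norm (g : 'cV[R]_n -> \bar R) : \bar R := 'N[mu]_(p%:E)[g].

Definition weak_Lp_norm (g : 'cV[R]_n -> \bar R) : \bar R :=
  ereal_sup [set alpha%:E * mu [set x | alpha%:E < `|g x|] `^ p^-1 |
    alpha in [set alpha | (0 < alpha)%R]].

Definition Lp_bounded (Phi : ('cV[R]_n -> R) -> \bar R) : Prop :=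
  exists C : R, forall f : 'cV[R]_n -> R, f \in Lfun mu p%:E ->
    Phi f <= C%:E * Lp_norm (EFin \o f).

End Lp_spaces.

(* Main.v *)
Require Import Defs.
From mathcomp Require Import all_boot all_order all_algebra perm.
From mathcomp Require Import all_classical all_reals all_analysis.
From mathcomp Require Import measurable_realfun.
From mathcomp Require Import complex ring lra.

Set Implicit Arguments.
Unset Strict Implicit.
Unset Printing Implicit Defensive.

Import Order.TTheory GRing.Theory Num.Theory.
Import numFieldNormedType.Exports.

Local Open Scope classical_set_scope.
Local Open Scope ring_scope.

(* Let f be the indicator of the cube [-1, 1]^n. Since e^{tB} -> 0 and, for t
   away from 0, Q_t stays between two positive multiples of the identity, for
   every M there is t with H_t f >= d on [-M, M]^n, where d > 0 does not depend
   on M. For one fixed small s, e^{sB} is close to the identity, so the density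
   of gamma_s is small on the cube around e^{sB} x for large x, and there
   H_s f(x) <= d / 2. Hence on cubes of arbitrarily large volume, away from the
   origin, the trajectory of f jumps by at least d / 2 between the times s and
   t, and each of the four operators is bounded below by a fixed constant. *)

(** As [t] grows, [H_t f(x)] tends to the mass that [gamma_oo] gives to the cube, a positive
    constant independent of [x]; nonzero constants are not in [L^p(dx)], and this is the source of
    the failure. The limit itself is avoided: a lower bound [d] for the density needs only an upper
    bound for [det Q_t] and a lower bound for the form of [Q_t], both uniform in large [t].
    Largeness of [H_t f] alone would settle only the maximal operator. The other three see
    differences, hence the second time [s], at which [H_s f] has to be small. The order of choices
    matters: [s], the jump size and the distance from the origin are fixed before [M], while [t]
    depends on [M] but not on [x]. Uniformity in [x] is indispensable for the oscillation, whose
    time sequence is chosen before the norm in [x] is taken. Since [f] never varies, each inequality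
    fails because its left side is infinite at this single [f]. *)

(* The operators are suprema over uncountable families, so their lower bounds
   are integrated without a measurability hypothesis. *)
Section nonmeasurable_monotonicity.
Local Open Scope ereal_scope.

Lemma ge0_le_integral_nonmeas d (T : measurableType d) (R : realType)
    (mu : {measure set T -> \bar R}) (f g : T -> \bar R) :
  (forall x, 0 <= f x) -> (forall x, f x <= g x) ->
  \int[mu]_x f x <= \int[mu]_x g x.
Proof.
move=> f0 fg; rewrite !ge0_integralTE//; last by move=> x; exact: le_trans (fg x).
apply: le_ereal_sup => _ [h /= hf <-]; exists h => //= x.
exact: le_trans (fg x).
Qed.

(** The sets may be nonmeasurable, as superlevel sets of the operators can be. The product measure
    is by definition the integral of the measures of sections, a formula that is monotone on all
    sets by induction on the dimension. *)
Lemma lebesgue_cV_le (R : realType) n (A B : set 'cV[R]_n) :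
  A `<=` B -> lebesgue_cV R n A <= lebesgue_cV R n B.
Proof.
elim: n A B => [|n IH] A B AB /=.
  rewrite !diracE lee_fin ler_nat; case: (boolP (0%R \in A)) => //= /set_mem/AB.
  by move=> B0; rewrite mem_set.
rewrite /lebesgue_succ /pushforward /product_measure1.
apply: ge0_le_integral_nonmeas => x /=; first exact: measure_ge0.
by apply: IH => y; rewrite /xsection/= !inE => /AB.
Qed.

Section Lp_norm_ge.
Context (R : realType) (n : nat) (p c : R).
Context (A : set 'cV[R]_n) (g : 'cV[R]_n -> \bar R).
Local Notation mu := (lebesgue_cV R n).
Hypothesis p1 : (1 <= p)%R.
Hypothesis c0 : (0 < c)%R.
Hypothesis mA : measurable A.
Hypothesis gA : forall x, A x -> c%:E <= `|g x|.

Lemma Lp_norm_ge : c%:E * mu A `^ p^-1 <= Lp_norm p g.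
Proof.
have p0 : (0 < p)%R by exact: lt_le_trans p1.
rewrite /Lp_norm unlock.
have -> : c%:E = (c%:E `^ p) `^ p^-1.
  by rewrite -poweRrM mulfV ?gt_eqF// poweRe1// lee_fin ltW.
rewrite -poweRM ?poweR_ge0//.
apply: gt0_ler_poweR; rewrite ?invr_ge0 ?(ltW p0)//.
- by rewrite in_itv/= leey andbT mule_ge0 ?measure_ge0 ?lee_fin ?powR_ge0.
- by rewrite in_itv/= leey andbT integral_ge0// => x _; exact: poweR_ge0.
rewrite -integral_cst// integral_mkcond.
apply: ge0_le_integral_nonmeas => x; rewrite /patch; case: ifPn => xA //.
- by rewrite poweR_ge0.
- apply: gt0_ler_poweR; rewrite ?(ltW p0) ?in_itv/= ?leey ?andbT//.
    by rewrite lee_fin ltW.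
  by apply: gA; exact: set_mem.
- exact: poweR_ge0.
Qed.

Lemma weak_Lp_norm_ge : (c / 2)%:E * mu A `^ p^-1 <= weak_Lp_norm p g.
Proof.
have p0 : (0 < p)%R by exact: lt_le_trans p1.
(* The superlevel sets of [weak_Lp_norm] are strict, so the level is [c / 2] instead of [c]. *)
apply: le_trans (ereal_sup_ubound _); last first.
  by exists (c / 2)%R => //=; rewrite divr_gt0.
apply: lee_wpmul2l; first by rewrite lee_fin divr_ge0// ltW.
apply: gt0_ler_poweR; rewrite ?invr_ge0 ?(ltW p0) ?in_itv/= ?leey ?andbT//.
apply: lebesgue_cV_le => x Ax /=; apply: lt_le_trans (gA Ax).
by rewrite lte_fin ltr_pdivrMr// ltr_pMr// ltr1n.
Qed.

Lemma Lp_weak_Lp_norm_ge X : X = @Lp_norm R n p \/ X = @weak_Lp_norm R n p ->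
  (c / 2)%:E * mu A `^ p^-1 <= X g.
Proof.
case=> ->; last exact: weak_Lp_norm_ge.
apply: le_trans Lp_norm_ge; apply: lee_wpmul2r; first exact: poweR_ge0.
by rewrite lee_fin ler_pdivrMr// ler_pMr// ler1n.
Qed.

End Lp_norm_ge.
End nonmeasurable_monotonicity.

(** * Cubes and their Lebesgue measure *)

Section box.
Context (R : realType) (n : nat).

Lemma measurable_box (A : 'I_n -> set (measurableTypeR R)) :
  (forall i, measurable (A i)) ->
  measurable [set x : 'cV[R]_n | forall i, A i (x i ord0)].
Proof.
move=> mA; rewrite (_ : [set x | _] =
    \bigcap_(i in [set: 'I_n]) cV_coord i @^-1` A i).
  apply: fin_bigcap_measurable => // i _; rewrite -[X in measurable X]setTI.
  exact: (measurable_cV_coord i measurableT (mA i)).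
by apply/seteqP; split => x /= xA i => [_|]; exact: xA.
Qed.

Definition box (z : 'cV[R]_n) (r : R) : set 'cV[R]_n :=
  [set x | forall i, x i ord0 \in `[z i ord0 - r, z i ord0 + r]].

Lemma boxP z r x : box z r x <-> forall i, `|x i ord0 - z i ord0| <= r.
Proof.
split=> + i => /(_ i); rewrite /box/= in_itv/= ler_norml => /andP[? ?];
  by apply/andP; split; lra.
Qed.

Lemma box0P r x : box 0 r x <-> forall i, `|x i ord0| <= r.
Proof.
have E i : `|x i ord0| = `|x i ord0 - (0 : 'cV[R]_n) i ord0|.
  by rewrite [X in _ - X]mxE subr0.
by split => [/boxP + i|h]; [rewrite E|apply/boxP => i; rewrite -E].
Qed.

Lemma boxE z r : box z r =
  [set x | forall i, [set` `[z i ord0 - r, z i ord0 + r]] (x i ord0)].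
Proof. by []. Qed.

Lemma measurable_box_center z r : measurable (box z r).
Proof.
exact: (@measurable_box (fun i => [set` `[z i ord0 - r, z i ord0 + r]])).
Qed.

Lemma lebesgue_cV_box_center z r :
  0 <= r -> lebesgue_cV R n (box z r) = ((r *+ 2) ^+ n)%:E.
Proof.
move=> r0; rewrite boxE.
rewrite (@lebesgue_cV_box _ _ (fun i => [set` `[z i ord0 - r, z i ord0 + r]]))//.
transitivity (\prod_(i < n) ((r *+ 2)%:E : \bar R))%E.
  apply: eq_bigr => i _; rewrite lebesgue_measure_itv/= lte_fin.
  rewrite -EFinB; case: ifPn => [_|]; first by congr EFin; rewrite mulr2n; ring.
  by rewrite -leNgt => ?; congr EFin; rewrite mulr2n; lra.
by rewrite prodEFin prodr_const card_ord.
Qed.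

End box.

(** * Quadratic forms *)

Section quadratic_form.
Context (R : realType) (n : nat).
Implicit Types (A : 'M[R]_n) (x y : 'cV[R]_n).

Definition qform A x : R := (x^T *m A *m x) ord0 ord0.

Definition sqnorm x : R := \sum_i x i ord0 ^+ 2.

Definition mx_l1 A : R := \sum_i \sum_j `|A i j|.

Lemma qformE A x : qform A x = \sum_i \sum_j x i ord0 * A i j * x j ord0.
Proof.
rewrite /qform mxE exchange_big /=; apply: eq_bigr => j _.
by rewrite mxE mulr_suml; apply: eq_bigr => i _; rewrite mxE.
Qed.

Lemma sqnormE x : sqnorm x = (x^T *m x) ord0 ord0.
Proof. by rewrite mxE; apply: eq_bigr => i _; rewrite mxE expr2. Qed.

Lemma sqnorm_ge0 x : 0 <= sqnorm x.
Proof. by apply: sumr_ge0 => i _; rewrite sqr_ge0. Qed.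

Lemma mx_l1_ge0 A : 0 <= mx_l1 A.
Proof. by apply: sumr_ge0 => i _; apply: sumr_ge0. Qed.

Lemma sqr_coord_le_sqnorm x i : x i ord0 ^+ 2 <= sqnorm x.
Proof.
rewrite /sqnorm (bigD1 i)//= lerDl; apply: sumr_ge0 => j _; exact: sqr_ge0.
Qed.

Lemma sqnorm_gt0 x : x != 0 -> 0 < sqnorm x.
Proof.
move=> x0; have /existsP[i xi0] : [exists i, x i ord0 != 0].
  apply: contraNT x0 => /existsPn x0; apply/eqP/colP => i; rewrite mxE.
  exact/eqP/negPn/x0.
by apply: lt_le_trans (sqr_coord_le_sqnorm x i); rewrite exprn_even_gt0.
Qed.

Lemma qform_le A x : `|qform A x| <= mx_l1 A * sqnorm x.
Proof.
rewrite qformE (le_trans (ler_norm_sum _ _ _))// /mx_l1 mulr_suml.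
apply: ler_sum => i _; rewrite (le_trans (ler_norm_sum _ _ _))// mulr_suml.
apply: ler_sum => j _; rewrite !normrM mulrAC mulrC ler_wpM2l//.
have := sqr_coord_le_sqnorm x i; have := sqr_coord_le_sqnorm x j.
rewrite -(real_normK (num_real (x i ord0))) -(real_normK (num_real (x j ord0))).
have := sqr_ge0 (`|x i ord0| - `|x j ord0|); nra.
Qed.

Lemma posdefmx_qform_gt0 A x : posdefmx A -> x != 0 -> 0 < qform A x.
Proof. by case=> _ /(_ x). Qed.

Lemma posdefmx_unit A : posdefmx A -> A \in unitmx.
Proof.
move=> pA; rewrite -row_free_unit -kermx_eq0; apply/eqP/row_matrixP => i.
rewrite row0; set u := row i _.
have uA : u *m A = 0 by apply/sub_kermxP/row_sub.
apply/eqP; rewrite -trmx_eq0; apply/negPn/negP => u0.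
by have := posdefmx_qform_gt0 pA u0; rewrite /qform trmxK uA mul0mx mxE ltxx.
Qed.

Lemma qformVE A y : A^T = A -> A \in unitmx -> qform (invmx A) (A *m y) = qform A y.
Proof.
by move=> sA uA; rewrite /qform trmx_mul sA !mulmxA mulmxK.
Qed.

Lemma posdefmx_inv A : posdefmx A -> posdefmx (invmx A).
Proof.
move=> pA; have uA := posdefmx_unit pA; have sA := pA.1.
split=> [|x x0]; first by rewrite trmx_inv sA.
have /(posdefmx_qform_gt0 pA) : invmx A *m x != 0.
  by apply: contra_neq x0 => /(congr1 (mulmx A)); rewrite mulKVmx// mulmx0.
by rewrite -qformVE// mulKVmx.
Qed.

(* Expand [0 <= qform A (x - s A^-1 x)] and bound the quadratic form of [A^-1]. *)
Lemma posdefmx_coercive A : posdefmx A ->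
  exists2 m, 0 < m & forall x, m * sqnorm x <= qform A x.
Proof.
move=> pA; have uA := posdefmx_unit pA; have sA := pA.1.
(* With step [K^-1] the quadratic term of the expansion is at most [K^-1 * sqnorm x], half of what
   the cross term removes, so [K^-1] is the coercivity constant. The summand 1 keeps [K]
   positive. *)
set K := 1 + mx_l1 (invmx A).
have K0 : 0 < K by rewrite ltr_pwDl// mx_l1_ge0.
exists K^-1; first by rewrite invr_gt0.
move=> x; set y := x - K^-1 *: (invmx A *m x).
have : 0 <= qform A y.
  by have [->|/(posdefmx_qform_gt0 pA)/ltW//] := eqVneq y 0;
    rewrite /qform mulmx0 mxE.
have -> : qform A y =
    qform A x - 2 * K^-1 * sqnorm x + K^-1 ^+ 2 * qform (invmx A) x.
  have yT : y^T = x^T - K^-1 *: (x^T *m invmx A).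
    by rewrite /y linearB linearZ/= trmx_mul trmx_inv sA.
  rewrite /qform sqnormE yT /y !mulmxBl !mulmxBr -!scalemxAl -!scalemxAr !mulmxA.
  rewrite !(mulmxKV uA, mulmxK uA) !mxE; ring.
have : qform (invmx A) x <= K * sqnorm x.
  apply: le_trans (ler_norm _) _; apply: le_trans (qform_le _ _) _.
  by rewrite ler_wpM2r ?sqnorm_ge0// /K lerDr.
have Ki : K^-1 * K = 1 by rewrite mulVf// gt_eqF.
have Ki0 : 0 < K^-1 by rewrite invr_gt0.
move=> h1 h2.
have : K^-1 ^+ 2 * qform (invmx A) x <= K^-1 * sqnorm x.
  apply: le_trans (ler_wpM2l (sqr_ge0 _) h1) _.
  by rewrite expr2 mulrA -(mulrA _ _ K) Ki mulr1.
lra.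
Qed.

(** For [y = A^-1 x] the form is the inner product of [y] and [x]. Young's inequality bounds it by
    [m / 2 * sqnorm y + sqnorm x / (2 * m)], and coercivity absorbs the first term into half of the
    form. *)
Lemma qform_inv_le A m x : posdefmx A -> 0 < m ->
  (forall y, m * sqnorm y <= qform A y) -> qform (invmx A) x <= sqnorm x / m.
Proof.
move=> pA m0 mA; have uA := posdefmx_unit pA; have sA := pA.1.
set y := invmx A *m x.
have xE : x = A *m y by rewrite mulKVmx.
have qE : qform (invmx A) x = qform A y by rewrite xE qformVE.
have qxy : qform A y = \sum_i y i ord0 * x i ord0.
  by rewrite /qform -mulmxA -xE mxE; apply: eq_bigr => i _; rewrite mxE.
suff : qform A y <= m / 2 * sqnorm y + sqnorm x / (2 * m).
  rewrite qE => h; have := mA y; have -> : sqnorm x / m = 2 * (sqnorm x / (2 * m)).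
    by field; rewrite gt_eqF.
  lra.
rewrite qxy /sqnorm mulr_sumr mulr_suml -big_split/=; apply: ler_sum => i _.
have -> : m / 2 * y i ord0 ^+ 2 + x i ord0 ^+ 2 / (2 * m) =
    y i ord0 * x i ord0 + (m * y i ord0 - x i ord0) ^+ 2 / (2 * m).
  by field; rewrite gt_eqF.
by rewrite lerDl divr_ge0 ?sqr_ge0// mulr_ge0// ltW.
Qed.

End quadratic_form.

(** * The matrix exponential *)

Section matrix_exponential.
Context (R : realType) (n : nat).
Implicit Types (A M : 'M[R]_n) (t : R).

(** Taylor coefficients in [t] of an entry of [e^{tA} M]. The factor [M] makes the family stable
    under differentiation, which replaces [M] by [A M]. *)
Definition expmx_coef A M i j (k : nat) : R := (k`!%:R)^-1 * (A ^+ k *m M) i j.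

Lemma mx_entry_le A i j : `|A i j| <= mx_l1 A.
Proof.
rewrite /mx_l1 (bigD1 i)//= (bigD1 j)//= -addrA lerDl addr_ge0//.
  by apply: sumr_ge0.
by apply: sumr_ge0 => k _; apply: sumr_ge0.
Qed.

Lemma mx_exp_entry_le A M k i j : `|(A ^+ k *m M) i j| <= mx_l1 A ^+ k * mx_l1 M.
Proof.
elim: k i => [|k IH] i.
  by rewrite expr0 mul1r -[1]/(1%:M) mul1mx mx_entry_le.
rewrite exprS -[A * _]/(A *m _) -mulmxA mxE (le_trans (ler_norm_sum _ _ _))//.
apply: (@le_trans _ _ (\sum_l `|A i l| * (mx_l1 A ^+ k * mx_l1 M))).
  by apply: ler_sum => l _; rewrite normrM ler_wpM2l.
rewrite -mulr_suml exprS -mulrA ler_wpM2r ?mulr_ge0 ?exprn_ge0 ?mx_l1_ge0//.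
by rewrite /mx_l1 [leRHS](bigD1 i)//= lerDl; do 2 apply: sumr_ge0 => *.
Qed.

Lemma is_cvg_expmx_coef A M i j t : cvgn (pseries (expmx_coef A M i j) t).
Proof.
apply: normed_cvg.
apply: (@series_le_cvg _ _ (fun k => mx_l1 M * exp_coeff (mx_l1 A * `|t|) k)).
- by move=> k /=; exact: normr_ge0.
- by move=> k; rewrite mulr_ge0 ?mx_l1_ge0// exp_coeff_ge0// mulr_ge0// mx_l1_ge0.
- move=> k; rewrite /expmx_coef /exp_coeff/= !normrM normrX exprMn.
  rewrite ger0_norm ?invr_ge0 ?ler0n//.
  rewrite mulrAC (_ : mx_l1 M * _ =
      (k`!%:R)^-1 * `|t| ^+ k * (mx_l1 A ^+ k * mx_l1 M)).
    by rewrite ler_wpM2l ?mulr_ge0 ?invr_ge0 ?exprn_ge0// mx_exp_entry_le.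
  by ring.
- have /(is_cvg_seriesZ (k := mx_l1 M)) := is_cvg_series_exp_coeff (mx_l1 A * `|t|).
  exact.
Qed.

Lemma pseries_diffs_expmx_coef A M i j :
  pseries_diffs (expmx_coef A M i j) = expmx_coef A (A *m M) i j.
Proof.
apply/funext => k; rewrite /pseries_diffs /expmx_coef factS natrM invfM.
by rewrite mulrA mulrA mulfV// mul1r exprSr -[_ * A]/(_ *m A) mulmxA.
Qed.

Lemma cvg_mxP (F : nat -> 'M[R]_n) M :
  (forall i j, (fun k => F k i j) @ \oo --> M i j) -> F @ \oo --> M.
Proof.
move=> FM; apply/cvg_mx_entourageP => U entU.
apply: filter_forall => i; apply: filter_forall => j.
have /cvg_entourageP/(_ U entU) := FM i j.
apply: (@filterS _ \oo _ (fun k => U (M i j, F k i j))) => k Uk.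
exact: mem_set.
Qed.

Lemma mx_exprZ t A k : (t *: A) ^+ k = t ^+ k *: A ^+ k.
Proof.
elim: k => [|k IH]; first by rewrite !expr0 scale1r.
rewrite !exprS IH -[X in X = _]/(_ *m _) -[A * _]/(A *m _).
by rewrite -scalemxAl -scalemxAr scalerA.
Qed.

Lemma expmxE A t i j : expmx (t *: A) i j = limn (pseries (expmx_coef A 1%:M i j) t).
Proof.
rewrite /expmx.
pose L := \matrix_(i, j) limn (pseries (expmx_coef A 1%:M i j) t).
suff -> : limn (series (fun k => (k`!%:R)^-1 *: (t *: A) ^+ k)) = L by rewrite mxE.
apply: cvg_lim => //; apply: cvg_mxP => {}i {}j; rewrite mxE.
rewrite (_ : (fun k => _) = pseries (expmx_coef A 1%:M i j) t).
  exact: is_cvg_expmx_coef.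
apply/funext => k; rewrite /pseries /series/= summxE; apply: eq_bigr => l _.
by rewrite /expmx_coef mulmx1 mx_exprZ !mxE; ring.
Qed.

Lemma mulmx_expmxE A M t i j :
  (expmx (t *: A) *m M) i j = limn (pseries (expmx_coef A M i j) t).
Proof.
rewrite mxE; apply/esym/cvg_lim => //.
rewrite (_ : pseries (expmx_coef A M i j) t = fun k =>
    \sum_l pseries (expmx_coef A 1%:M i l) t k * M l j).
  apply: cvg_big => [|l _]; first exact: add_continuous.
  rewrite expmxE; apply: cvgM; first exact: is_cvg_expmx_coef.
  exact: cvg_cst.
apply/funext => k; rewrite /pseries /series/=.
under [RHS]eq_bigr do rewrite mulr_suml.
rewrite exchange_big/=; apply: eq_bigr => m _.
rewrite /expmx_coef mxE mulr_sumr mulr_suml; apply: eq_bigr => l _.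
by rewrite mulmx1; ring.
Qed.

Lemma is_derive_expmx A M t i j :
  is_derive t 1 (fun s => (expmx (s *: A) *m M) i j)
    ((expmx (t *: A) *m (A *m M)) i j).
Proof.
under eq_fun do rewrite mulmx_expmxE.
rewrite mulmx_expmxE -pseries_diffs_expmx_coef.
(* Termwise differentiation asks for convergence at some point of modulus larger than [|t|]; the
   series converges everywhere. *)
apply: (@pseries_snd_diffs _ _ (`|t| + 1)).
- exact: is_cvg_expmx_coef.
- by rewrite pseries_diffs_expmx_coef; exact: is_cvg_expmx_coef.
- by rewrite !pseries_diffs_expmx_coef; exact: is_cvg_expmx_coef.
- by rewrite [ltRHS]ger0_norm// ?ltrDl// addr_ge0.
Qed.

Lemma expmx_tr A t : expmx (t *: A^T) = (expmx (t *: A))^T.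
Proof.
apply/matrixP => i j; rewrite mxE !expmxE; congr (limn (pseries _ t)).
apply/funext => k; rewrite /expmx_coef !mulmx1; congr (_ * _).
suff -> : A^T ^+ k = (A ^+ k)^T by rewrite mxE.
elim: k => [|k IH]; first by rewrite !expr0 trmx1.
by rewrite exprS exprSr -[A ^+ k * A]/(_ *m A) trmx_mul -IH.
Qed.

Lemma expmx0 A : expmx (0 *: A) = 1%:M.
Proof.
apply/matrixP => i j; rewrite expmxE; apply/cvg_lim => //.
(* The empty partial sum is 0, so the partial sums are constant only from index 1 on. *)
rewrite -(cvg_shiftS (pseries _ _))/=.
rewrite (_ : (fun k => _) = cst ((1%:M : 'M[R]_n) i j)); first exact: cvg_cst.
apply/funext => k; rewrite /pseries /series/= big_nat_recl//= big1 ?addr0.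
  by rewrite /expmx_coef fact0 invr1 mul1r expr0 mulr1 mulmx1.
by move=> l _; rewrite expr0n/= mulr0.
Qed.

Lemma continuous_expmx A i j : continuous (fun t => expmx (t *: A) i j).
Proof.
move=> t; have := is_derive_expmx A 1%:M t i j.
under eq_fun do rewrite mulmx1.
by move=> [/derivable1_diffP/differentiable_continuous].
Qed.

End matrix_exponential.

(** * Decay of [e^{tB}] from the spectrum of [B] *)

Section exponential_decay.
Context (R : realType).

Lemma is_derive_expR_mul (k t : R) :
  is_derive t (1 : R) (fun s => expR (k * s)) (k * expR (k * t)).
Proof.
have dk : is_derive t (1 : R) (fun s : R => k * s) k.
  have := @is_deriveZ _ _ _ id k t 1 1 (is_derive_id _ _).
  by move/is_derive_eq; apply; exact: mulr1.
have := @is_derive1_comp _ expR (fun s => k * s) t _ _ (is_derive_expR _) dk.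
by rewrite mulrC.
Qed.

(** A Gronwall argument: for [b] below both rates, [g t * expR (b * t)] plus a correction is
    nonincreasing on [t >= 0]. The derivative of the correction [C / (c - b) * expR (- (c - b) * t)]
    cancels the forcing term. Taking [b] strictly smaller than [a] and [c] also covers [a = c],
    where the rate [a] itself may be lost to a factor [t]. *)
Lemma ode_le_expR (g g' : R -> R) (a c C : R) :
  0 < a -> 0 < c -> 0 <= C -> (forall t, 0 <= g t) ->
  (forall t : R, is_derive t (1 : R) g (g' t)) ->
  (forall t, 0 <= t -> g' t <= - a * g t + C * expR (- c * t)) ->
  exists C' c', 0 < c' /\ forall t, 0 <= t -> g t <= C' * expR (- c' * t).
Proof.
move=> a0 c0 C0 g0 dg g'le.
have [b [b0 ba bc]] : exists b, [/\ 0 < b, b < a & b < c].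
  have m0 : 0 < Num.min a c by rewrite lt_min a0.
  exists (Num.min a c / 2).
  have : Num.min a c <= a by rewrite ge_min lexx.
  have : Num.min a c <= c by rewrite ge_min lexx orbT.
  by split; lra.
pose G t := g t * expR (b * t) + C / (c - b) * expR (- (c - b) * t).
pose G' t := (g' t + b * g t) * expR (b * t) - C * expR (- (c - b) * t).
have dexp := is_derive_expR_mul.
have dG t : is_derive t (1 : R) G (G' t).
  have := is_deriveD (is_deriveM (dg t) (dexp b t))
    (@is_deriveZ _ _ _ _ (C / (c - b)) _ _ _ (dexp (- (c - b)) t)).
  move/is_derive_eq; apply; rewrite /G' /= /GRing.scale/=; field.
  by rewrite subr_eq0 gt_eqF.
have G'le t : 0 <= t -> G' t <= 0.
  move=> t0; rewrite /G'.
  have e0 : 0 < expR (b * t) by exact: expR_gt0.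
  have eE : expR (- (c - b) * t) = expR (- c * t) * expR (b * t).
    by rewrite -expRD; congr expR; ring.
  rewrite eE mulrA -mulrBl; apply: mulr_le0_ge0; last exact: ltW.
  have := g'le t t0; have := g0 t; nra.
have Gle t : 0 <= t -> G t <= G 0.
  move=> t0; apply: (@ler0_derive1_le _ G 0 t _ _ true false) => //.
  - move=> x; rewrite in_itv/= => /andP[x0 _].
    by rewrite derive1E derive_val G'le// ltW.
  - apply: continuous_subspaceT => x.
    by have [/derivable1_diffP/differentiable_continuous] := dG x.
  - by rewrite in_itv/= lexx t0.
  - by rewrite in_itv/= lexx t0.
exists (G 0), b; split=> // t t0.
have e1 : expR (b * t) * expR (- b * t) = 1 by rewrite -expRD mulNr addrN expR0.
rewrite -[leLHS]mulr1 -e1 mulrA ler_wpM2r ?expR_ge0//; apply: le_trans (Gle t t0).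
by rewrite /G lerDl mulr_ge0 ?expR_ge0// divr_ge0// subr_ge0 ltW.
Qed.

End exponential_decay.

Section expmx_decay.
Context (R : realType) (n : nat) (B : 'M[R]_n.+1).
Local Notation C := R[i].
Local Notation BC := (map_mx (real_complex R) B).
Local Notation E t := (expmx (t *: B)).
Implicit Types W : 'M[C]_n.+1.

Let mxRe W := map_mx (@complex.Re R) W.
Let mxIm W := map_mx (@complex.Im R) W.

(** Squared Frobenius norm of [e^{tB} W]. As [B] is real, the real and imaginary parts of the
    complex matrix [W] evolve separately, and only the real exponential is needed. *)
Let nrm2 W t := \sum_i \sum_j
  (((E t *m mxRe W) i j) ^+ 2 + ((E t *m mxIm W) i j) ^+ 2).

Let decays W := exists K c, 0 < c /\
  forall t, 0 <= t -> nrm2 W t <= K * expR (- c * t).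

(** With [V = (B - z) W], the curve [w = e^{tB} W] solves [w' = z w + e^{tB} V]. In the derivative
    of [|w|^2] the imaginary part of [z] cancels and the real part gives [2 Re z |w|^2]. Half of
    this absorbs the cross term with [e^{tB} V], which decays by assumption, and [ode_le_expR]
    applies. *)
Let decays_step W (z : C) : complex.Re z < 0 ->
  decays (BC *m W - z *: W) -> decays W.
Proof.
have hRe (x y w : C) : complex.Re x =
    complex.Re (x - y * w) + complex.Re y * complex.Re w -
    complex.Im y * complex.Im w.
  by case: x y w => [? ?] [? ?] [? ?] /=; ring.
have hIm (x y w : C) : complex.Im x =
    complex.Im (x - y * w) + complex.Re y * complex.Im w +
    complex.Im y * complex.Re w.
  by case: x y w => [? ?] [? ?] [? ?] /=; ring.
set V := BC *m W - _; set a := complex.Re z; set b := complex.Im z.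
move=> a0 [K [c [c0 HV]]].
have ReE : B *m mxRe W = mxRe V + a *: mxRe W - b *: mxIm W.
  apply/matrixP => i j; rewrite !mxE.
  rewrite (_ : \sum__ _ = complex.Re (\sum_k (BC i k) * W k j)).
    exact: hRe.
  rewrite (big_morph (@complex.Re R) (id1 := 0) (op1 := +%R))//;
    last by case=> ? ? [].
  by apply: eq_bigr => k _; rewrite !mxE; case: (W k j) => u v /=; ring.
have ImE : B *m mxIm W = mxIm V + a *: mxIm W + b *: mxRe W.
  apply/matrixP => i j; rewrite !mxE.
  rewrite (_ : \sum__ _ = complex.Im (\sum_k (BC i k) * W k j)).
    exact: hIm.
  rewrite (big_morph (@complex.Im R) (id1 := 0) (op1 := +%R))//;
    last by case=> ? ? [].
  by apply: eq_bigr => k _; rewrite !mxE; case: (W k j) => u v /=; ring.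
pose u i j t := (E t *m mxRe W) i j; pose v i j t := (E t *m mxIm W) i j.
pose u' i j t := (E t *m mxRe V) i j; pose v' i j t := (E t *m mxIm V) i j.
have du i j t : is_derive t (1 : R) (u i j) (u' i j t + a * u i j t - b * v i j t).
  have := is_derive_expmx B (mxRe W) t i j.
  move/is_derive_eq; apply.
  by rewrite ReE mulmxBr mulmxDr -!scalemxAr /u' /u /v !mxE.
have dv i j t : is_derive t (1 : R) (v i j) (v' i j t + a * v i j t + b * u i j t).
  have := is_derive_expmx B (mxIm W) t i j.
  move/is_derive_eq; apply.
  by rewrite ImE !mulmxDr -!scalemxAr /v' /u /v !mxE.
pose g' t := \sum_i \sum_j (2 * u i j t * (u' i j t + a * u i j t - b * v i j t) +
  2 * v i j t * (v' i j t + a * v i j t + b * u i j t)).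
have dg t : is_derive t (1 : R) (nrm2 W) (g' t).
  rewrite (_ : nrm2 W = \sum_i \sum_j (u i j ^+ 2 + v i j ^+ 2)); last first.
    by apply/funext => s; rewrite fct_sumE; apply: eq_bigr => i _; rewrite fct_sumE.
  have H i j : is_derive t (1 : R) (u i j ^+ 2 + v i j ^+ 2)
      (2 * u i j t * (u' i j t + a * u i j t - b * v i j t) +
       2 * v i j t * (v' i j t + a * v i j t + b * u i j t)).
    have := is_deriveD (is_deriveX 2 (du i j t)) (is_deriveX 2 (dv i j t)).
    by move/is_derive_eq; apply; rewrite /= expr1.
  exact: (is_derive_sum (fun i => is_derive_sum (H i))).
apply: (@ode_le_expR _ _ g' (- a) c (`|K| / - a)) => //.
- by rewrite oppr_gt0.
- by rewrite divr_ge0// oppr_ge0 ltW.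
- by move=> t; do 2 apply: sumr_ge0 => ? _; rewrite addr_ge0 ?sqr_ge0.
move=> t t0.
apply: (@le_trans _ _ (a * nrm2 W t + nrm2 V t / - a)); last first.
  rewrite opprK lerD2l mulrAC ler_wpM2r ?invr_ge0 ?oppr_ge0 ?(ltW a0)//.
  by apply: le_trans (HV t t0) _; rewrite ler_wpM2r ?expR_ge0 ?ler_norm.
rewrite /nrm2 !mulr_sumr !mulr_suml -big_split/=; apply: ler_sum => i _.
rewrite !mulr_sumr !mulr_suml -big_split/=; apply: ler_sum => j _.
rewrite -/(u i j t) -/(v i j t) -/(u' i j t) -/(v' i j t).
(* [2 u u' <= - a u ^ 2 + u' ^ 2 / - a] *)
have am x y : 2 * x * y + a * x ^+ 2 <= y ^+ 2 / - a.
  rewrite ler_pdivlMr ?oppr_gt0//; have := sqr_ge0 (a * x + y); nra.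
have := am (u i j t) (u' i j t); have := am (v i j t) (v' i j t).
rewrite mulrDl; lra.
Qed.

Hypothesis spB : forall z : C, eigenvalue BC z -> complex.Re z < 0.

Let decays_prod (r : seq C) (p : {poly C}) :
  (forall z, z \in r -> complex.Re z < 0) ->
  decays (horner_mx BC (p * \prod_(z <- r) ('X - z%:P))) -> decays (horner_mx BC p).
Proof.
elim: r p => [|z r IH] p rN; first by rewrite big_nil mulr1.
rewrite big_cons mulrA => /IH H; apply: (@decays_step _ z).
  by rewrite rN// mem_head.
rewrite (_ : _ - _ = horner_mx BC (p * ('X - z%:P))).
  by apply: H => y yr; apply: rN; rewrite inE yr orbT.
(* Polynomials in [B] commute, so the factor [B - z] can be moved to the left, where [decays_step]
   expects it. *)
rewrite mulrC rmorphM rmorphB/= horner_mx_X horner_mx_C mulrBl.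
by rewrite -[z%:M * _]/(z%:M *m _) mul_scalar_mx.
Qed.

(* Cayley-Hamilton writes [0] as a product of factors [B - z] over the
   eigenvalues [z]; they are removed one at a time. *)
Lemma expmx_decay : exists K c, 0 < c /\
  forall t, 0 <= t -> forall i j, (E t) i j ^+ 2 <= K * expR (- c * t).
Proof.
have [r rE] := closed_field_poly_normal (char_poly BC).
rewrite (monicP (char_poly_monic _)) scale1r in rE.
have [K [c [c0 H]]] : decays 1%:M.
  have <- : horner_mx BC 1 = 1%:M by exact: rmorph1.
  apply: (@decays_prod r) => [z zr|].
    apply: spB; rewrite eigenvalue_root_char rE.
    by rewrite root_prod_XsubC.
  rewrite mul1r -rE; have := Cayley_Hamilton BC; set W := horner_mx _ _ => W0.
  have Re0 : mxRe W = 0 by apply/matrixP => i j; rewrite mxE W0 !mxE.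
  have Im0 : mxIm W = 0 by apply/matrixP => i j; rewrite mxE W0 !mxE.
  exists 0, 1; split=> // t _; rewrite mul0r /nrm2 Re0 Im0 mulmx0.
  by rewrite big1// => i _; rewrite big1// => j _; rewrite mxE expr0n addr0.
exists K, c; split=> // t t0 i j; apply: le_trans (H t t0).
have Re1 : mxRe 1%:M = 1%:M.
  by apply/matrixP => k l; rewrite !mxE; case: eqP.
rewrite /nrm2 Re1 (bigD1 i)//= (bigD1 j)//= mulmx1 -!addrA lerDl addr_ge0 ?sqr_ge0//.
rewrite addr_ge0//; first by apply: sumr_ge0 => *; rewrite addr_ge0 ?sqr_ge0.
by apply: sumr_ge0 => *; apply: sumr_ge0 => *; rewrite addr_ge0 ?sqr_ge0.
Qed.

End expmx_decay.

(** * Bounds on the covariance *)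

Section segment_integral.
Context (R : realType).
Local Notation mu := (@lebesgue_measure R).
Implicit Types (f : R -> R) (t : R).

Lemma integrable_segment f t : continuous f -> mu.-integrable `[0, t] (EFin \o f).
Proof.
move=> cf; apply: continuous_compact_integrable; first exact: segment_compact.
exact: continuous_subspaceT.
Qed.

Lemma continuous_sumr I (r : seq I) (F : I -> R -> R) :
  (forall i, continuous (F i)) -> continuous (fun s => \sum_(i <- r) F i s).
Proof.
by move=> cF s; apply: cvg_big => [|i _]; [exact: add_continuous|exact: cF].
Qed.

Lemma Rintegral_segment_sum I (r : seq I) (F : I -> R -> R) t :
  (forall i, continuous (F i)) ->
  \int[mu]_(s in `[0, t]) (\sum_(i <- r) F i s) =
  \sum_(i <- r) \int[mu]_(s in `[0, t]) F i s.
Proof.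
move=> cF; elim: r => [|i r IH].
  by under eq_Rintegral do rewrite big_nil; rewrite big_nil Rintegral_cst// mul0r.
rewrite big_cons -IH -RintegralD//.
- by apply: eq_Rintegral => s _; rewrite big_cons.
- exact: integrable_segment.
- by apply: integrable_segment; exact: continuous_sumr.
Qed.

Lemma Rintegral_expR_le (K c t : R) : 0 <= K -> 0 < c -> 0 < t ->
  \int[mu]_(s in `[0, t]) (K * expR (- c * s)) <= K / c.
Proof.
move=> K0 c0 t0; pose G s := - (K / c) * expR (- c * s).
have dG s : is_derive s (1 : R) G (K * expR (- c * s)).
  have := @is_deriveZ _ _ _ _ (- (K / c)) _ _ _ (is_derive_expR_mul (- c) s).
  move/is_derive_eq; apply; rewrite /GRing.scale/=; field.
  by rewrite gt_eqF.
have cG : continuous G.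
  by move=> s; have [/derivable1_diffP/differentiable_continuous] := dG s.
rewrite /Rintegral (@continuous_FTC2 _ _ G)//=.
- rewrite /G mulr0 expR0 mulr1 opprK gerDr mulNr oppr_le0.
  by rewrite mulr_ge0 ?expR_ge0// divr_ge0// ltW.
- apply: continuous_subspaceT => s; apply: cvgM; first exact: cvg_cst.
  have [/derivable1_diffP/differentiable_continuous] := is_derive_expR_mul (- c) s.
  exact.
- split=> [s _||]; first by have [] := dG s.
    exact/cvg_at_right_filter/cG.
  exact/cvg_at_left_filter/cG.
- by move=> s _; rewrite derive1E derive_val.
Qed.

End segment_integral.

Section perturbation.
Context (R : realType) (n : nat).

Lemma sqr_sum_le (a : 'I_n -> R) : (\sum_i a i) ^+ 2 <= n%:R * \sum_i a i ^+ 2.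
Proof.
have -> : n%:R * \sum_i a i ^+ 2 = \sum_i \sum_j (a i ^+ 2 + a j ^+ 2) / 2.
  transitivity (\sum_i ((n%:R * a i ^+ 2 + \sum_j a j ^+ 2) / 2)).
    rewrite -mulr_suml big_split/= -mulr_sumr sumr_const card_ord -mulr_natl.
    by field.
  apply: eq_bigr => i _; rewrite -mulr_suml big_split/= sumr_const card_ord.
  by rewrite mulr_natl.
rewrite expr2 mulr_suml; apply: ler_sum => i _; rewrite mulr_sumr.
by apply: ler_sum => j _; have := sqr_ge0 (a i - a j); nra.
Qed.

(** Write [M x = x + d]. By Cauchy-Schwarz the entrywise bound [1 / (2n)] makes [|d|^2] at most
    [|x|^2 / 4], and [|x + d|^2 >= |x|^2 / 2 - |d|^2]. *)
Lemma sqnorm_mulmx_ge (M : 'M[R]_n) (x : 'cV[R]_n) :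
  (forall i j, `|M i j - (i == j)%:R| <= (2 * n%:R)^-1) ->
  sqnorm x / 4 <= sqnorm (M *m x).
Proof.
move=> M1; pose d := (M - 1%:M) *m x.
have [n0|n0] := posnP n.
  have -> (y : 'cV[R]_n) : sqnorm y = 0.
    rewrite /sqnorm; apply: big1 => i _.
    have i0 : (0 < n)%N by exact: leq_ltn_trans (leq0n i) (ltn_ord i).
    by rewrite n0 in i0.
  by rewrite mul0r sqnorm_ge0.
have nR0 : 0 < n%:R :> R by rewrite ltr0n.
have dle i : d i ord0 ^+ 2 <= sqnorm x / (4 * n%:R).
  apply: (@le_trans _ _ (((2 * n%:R)^-1 * \sum_j `|x j ord0|) ^+ 2)).
    rewrite -[leLHS]real_normK ?num_real// lerXn2r ?qualifE/= ?mulr_ge0//.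
      exact: sumr_ge0.
    rewrite mxE mulr_sumr (le_trans (ler_norm_sum _ _ _))//.
    by apply: ler_sum => j _; rewrite normrM ler_wpM2r// !mxE M1.
  rewrite exprMn; apply: (@le_trans _ _ ((2 * n%:R)^-1 ^+ 2 * (n%:R * sqnorm x))).
    rewrite ler_wpM2l ?sqr_ge0//; apply: le_trans (sqr_sum_le _) _.
    rewrite ler_wpM2l//; apply: ler_sum => j _.
    by rewrite real_normK ?num_real.
  by rewrite le_eqVlt; apply/orP; left; apply/eqP; field; rewrite gt_eqF.
have -> : M *m x = x + d by rewrite /d mulmxBl mul1mx addrC subrK.
have dsum : sqnorm d <= sqnorm x / 4.
  apply: (@le_trans _ _ (\sum_(i < n) sqnorm x / (4 * n%:R))).
    by apply: ler_sum => i _; exact: dle.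
  rewrite sumr_const card_ord -mulr_natl.
  by rewrite le_eqVlt; apply/orP; left; apply/eqP; field; rewrite gt_eqF.
apply: (@le_trans _ _ (sqnorm x / 2 - sqnorm d)); first by lra.
rewrite /sqnorm mulr_suml -sumrB; apply: ler_sum => i _; rewrite [(x + d) _ _]mxE.
by have := sqr_ge0 (x i ord0 + 2 * d i ord0); nra.
Qed.

Lemma det_le (S : 'M[R]_n) K : (forall i j, `|S i j| <= K) ->
  \det S <= n`!%:R * K ^+ n.
Proof.
move=> SK; apply: le_trans (ler_norm _) _.
rewrite /determinant (le_trans (ler_norm_sum _ _ _))//.
apply: (@le_trans _ _ (\sum_(s : 'S_n) K ^+ n)); last first.
  by rewrite sumr_const card_Sn mulr_natl.
apply: ler_sum => s _; rewrite normrM normrX normrN1 expr1n mul1r normr_prod.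
rewrite -[X in K ^+ X]card_ord -prodr_const; apply: ler_prod => i _.
by rewrite normr_ge0 SK.
Qed.

End perturbation.

Section ou_covariance.
Context (R : realType) (n : nat) (Q B : 'M[R]_n).
Local Notation mu := (@lebesgue_measure R).
Local Notation E s := (expmx (s *: B)).
Hypothesis pQ : posdefmx Q.

Let F s := E s *m Q *m (E s)^T.

Let ou_covE t i j : ou_cov Q B t i j = \int[mu]_(s in `[0, t]) F s i j.
Proof. by rewrite mxE; apply: eq_Rintegral => s _; rewrite expmx_tr. Qed.

Let FE s i j : F s i j = \sum_k \sum_l E s i l * Q l k * E s j k.
Proof.
rewrite /F mxE; apply: eq_bigr => k _; rewrite !mxE mulr_suml.
by apply: eq_bigr => l _.
Qed.

Let continuous_F i j : continuous (fun s => F s i j).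
Proof.
under eq_fun do rewrite FE.
apply: continuous_sumr => k; apply: continuous_sumr => l s.
apply: cvgM; last exact: continuous_expmx.
by apply: cvgM; [exact: continuous_expmx|exact: cvg_cst].
Qed.

Lemma ou_cov_sym t : (ou_cov Q B t)^T = ou_cov Q B t.
Proof.
apply/matrixP => i j; rewrite mxE !ou_covE; apply: eq_Rintegral => s _.
have : (F s)^T = F s by rewrite /F !trmx_mul trmxK pQ.1 mulmxA.
by move=> /matrixP/(_ i j) <-; rewrite [RHS]mxE.
Qed.

Let qform_F s x : qform (F s) x = qform Q ((E s)^T *m x).
Proof. by rewrite /qform /F trmx_mul trmxK !mulmxA. Qed.

Let continuous_qform_F x : continuous (fun s => qform (F s) x).
Proof.
under eq_fun do rewrite qformE.
apply: continuous_sumr => k; apply: continuous_sumr => l s.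
apply: cvgM; last exact: cvg_cst.
by apply: cvgM; [exact: cvg_cst|exact: continuous_F].
Qed.

Let qform_ou_cov t x :
  qform (ou_cov Q B t) x = \int[mu]_(s in `[0, t]) qform (F s) x.
Proof.
rewrite qformE; under [RHS]eq_Rintegral do rewrite qformE.
have cF i j : continuous (fun s => x i ord0 * F s i j * x j ord0).
  move=> s; apply: cvgM; last exact: cvg_cst.
  by apply: cvgM; [exact: cvg_cst|exact: continuous_F].
rewrite Rintegral_segment_sum; last by move=> i; exact: continuous_sumr.
apply: eq_bigr => i _; rewrite Rintegral_segment_sum//; apply: eq_bigr => j _.
rewrite RintegralZr//; last first.
  apply: integrable_segment => s; apply: cvgM; first exact: cvg_cst.
  exact: continuous_F.
by rewrite RintegralZl ?ou_covE//; exact: integrable_segment.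
Qed.

Lemma expmx_near1 e : 0 < e -> exists2 s0, 0 < s0 &
  forall s, 0 <= s <= s0 -> forall i j, `|E s i j - (i == j)%:R| <= e.
Proof.
move=> e0.
have : \forall s \near nbhs (0 : R), forall i j, `|E s i j - (i == j)%:R| <= e.
  apply: filter_forall => i; apply: filter_forall => j.
  have /cvgrPdist_le/(_ e e0) := @continuous_expmx R n B i j 0.
  by apply: filterS => s; rewrite expmx0 mxE distrC.
move=> /nbhs_ballP[d /= d0 Hd]; exists (d / 2); first by rewrite divr_gt0.
move=> s /andP[s0 sd]; apply: Hd; rewrite /ball/= sub0r normrN ger0_norm//.
by apply: le_lt_trans sd _; lra.
Qed.

(** The integrand is nonnegative, so for [t >= s0] the integral is at least the one over [[0, s0]],
    where [e^{sB}] is close to the identity. The resulting constant does not depend on [t]. *)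
Lemma ou_cov_coercive s0 : 0 < s0 ->
  (forall s, 0 <= s <= s0 ->
     forall i j, `|E s i j - (i == j)%:R| <= (2 * n%:R)^-1) ->
  exists2 m, 0 < m & forall t x, s0 <= t -> m * sqnorm x <= qform (ou_cov Q B t) x.
Proof.
move=> s00 E1; have [m m0 Qm] := posdefmx_coercive pQ.
exists (s0 * (m / 4)); first by rewrite mulr_gt0// divr_gt0.
move=> t x st; rewrite qform_ou_cov.
have Fge s : 0 <= s <= s0 -> m / 4 * sqnorm x <= qform (F s) x.
  move=> /E1 sE; rewrite qform_F; apply: le_trans (Qm _).
  rewrite mulrAC -mulrA ler_wpM2l ?(ltW m0)//; apply: sqnorm_mulmx_ge => i j.
  by rewrite mxE eq_sym sE.
have F0 s : 0 <= qform (F s) x.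
  rewrite qform_F; apply: le_trans (Qm _).
  by rewrite mulr_ge0 ?sqnorm_ge0 ?(ltW m0).
have fi u := integrable_segment u (@continuous_qform_F x).
rewrite -lee_fin fineK; last exact: integrable_fin_num (fi t).
apply: (@le_trans _ _ (\int[mu]_(s in `[0%R, s0]) (qform (F s) x)%:E)%E); last first.
  apply: ge0_subset_integral => //.
  - by have /integrableP[] := fi t.
  - by move=> s _; rewrite lee_fin.
  - by move=> s/=; rewrite !in_itv/= => /andP[-> /le_trans]; exact.
rewrite -[leRHS]fineK; last exact: integrable_fin_num (fi s0).
rewrite lee_fin.
have -> : s0 * (m / 4) * sqnorm x =
    \int[mu]_(s in `[0, s0]) (m / 4 * sqnorm x).
  have ms0 : mu `[0, s0]%classic = s0%:E.
    by rewrite lebesgue_measure_itv/= lte_fin s00 oppr0 adde0.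
  transitivity (m / 4 * sqnorm x * fine (mu `[0, s0]%classic)).
    by rewrite ms0/=; ring.
  by apply/esym; exact: Rintegral_cst.
apply: le_Rintegral => //.
  by apply: integrable_segment; exact: cst_continuous.
Qed.

(** The integrand is quadratic in the entries of [e^{sB}], hence decays like [e^{-cs}], and its
    integral is bounded uniformly in [t]. The absolute value of [K] appears because the hypotheses
    do not fix its sign. *)
Lemma ou_cov_bounded K c : 0 < c ->
  (forall s, 0 <= s -> forall i j, E s i j ^+ 2 <= K * expR (- c * s)) ->
  forall t, 0 < t -> forall i j, `|ou_cov Q B t i j| <= `|K| * mx_l1 Q / c.
Proof.
move=> c0 EK t t0 i j; rewrite ou_covE.
apply: le_trans (le_normr_Rintegral _ _) _ => //.
  by apply: integrable_segment; exact: continuous_F.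
apply: le_trans (@Rintegral_expR_le _ (`|K| * mx_l1 Q) c t _ c0 t0); last first.
  by rewrite mulr_ge0// mx_l1_ge0.
apply: le_Rintegral => //.
- apply: integrable_segment => s; apply: continuous_comp.
    exact: continuous_F.
  exact: norm_continuous.
- apply: integrable_segment => s; apply: cvgM; first exact: cvg_cst.
  have [/derivable1_diffP/differentiable_continuous] := is_derive_expR_mul (- c) s.
  exact.
move=> s/=; rewrite in_itv/= => /andP[s0 _]; rewrite FE.
have EE k l : `|E s i l| * `|E s j k| <= `|K| * expR (- c * s).
  have h1 := le_trans (EK s s0 i l) (ler_wpM2r (expR_ge0 _) (ler_norm K)).
  have h2 := le_trans (EK s s0 j k) (ler_wpM2r (expR_ge0 _) (ler_norm K)).
  move: h1 h2; rewrite -(real_normK (num_real (E s i l))).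
  rewrite -(real_normK (num_real (E s j k))).
  by have := sqr_ge0 (`|E s i l| - `|E s j k|); nra.
rewrite exchange_big/= (le_trans (ler_norm_sum _ _ _))// mulrAC [leRHS]mulrC.
rewrite /mx_l1 mulr_suml; apply: ler_sum => l _.
rewrite (le_trans (ler_norm_sum _ _ _))// mulr_suml; apply: ler_sum => k _.
by rewrite mulrAC [X in `|X|]mulrC normrM ler_wpM2l// normrM.
Qed.

End ou_covariance.

(** * The semigroup on a cube *)

Section gaussian_bounds.
Context (R : realType) (n : nat) (S : 'M[R]_n).
Local Notation mu := (lebesgue_cV R n).

Definition gaussian_cst : R := (2 * pi) `^ (- (n%:R / 2)) * (\det S) `^ (- 2^-1).

Lemma gaussian_pdfE y : S^T = S ->
  gaussian_pdf S y = gaussian_cst * expR (- 2^-1 * qform (invmx S) y).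
Proof.
by move=> sS; rewrite /gaussian_pdf /gaussian_cst /qform trmx_mul trmx_inv sS.
Qed.

Lemma gaussian_cst_ge0 : 0 <= gaussian_cst.
Proof. by rewrite mulr_ge0 ?powR_ge0. Qed.

(* [ln] vanishes on negative reals, so the sign of the determinant is immaterial. *)
Lemma gaussian_cst_ge D : S \in unitmx -> 1 <= D -> \det S <= D ->
  (2 * pi) `^ (- (n%:R / 2)) * expR (- 2^-1 * ln D) <= gaussian_cst.
Proof.
move=> uS D1 SD; rewrite /gaussian_cst ler_wpM2l ?powR_ge0//.
have d0 : \det S != 0 by move: uS; rewrite unitmxE unitfE.
rewrite /powR (negbTE d0) ler_expR ler_nM2l ?oppr_lt0 ?invr_gt0//.
have [d1|d1] := ltP 0 (\det S).
  by rewrite ler_ln// posrE (lt_le_trans _ D1).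
by rewrite ln0// ln_ge0.
Qed.

Lemma gaussian_le (A : set 'cV[R]_n) k : measurable A ->
  (forall y, A y -> gaussian_pdf S y <= k) -> (gaussian S A <= k%:E * mu A)%E.
Proof.
move=> mA Ak; rewrite /gaussian -integral_cst//.
apply: ge0_le_integral => //.
- by move=> y _; rewrite lee_fin gaussian_pdf_ge0.
- apply/measurable_EFinP; apply: measurable_funTS; exact: measurable_gaussian_pdf.
Qed.

Lemma gaussian_ge (A A' : set 'cV[R]_n) k : measurable A -> measurable A' ->
  0 <= k -> A' `<=` A ->
  (forall y, A' y -> k <= gaussian_pdf S y) -> (k%:E * mu A' <= gaussian S A)%E.
Proof.
move=> mA mA' k0 AA' Ak; rewrite -integral_cst//.
apply: (@le_trans _ _ (gaussian S A')).
  apply: ge0_le_integral => //.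
  - apply/measurable_EFinP; apply: measurable_funTS; exact: measurable_gaussian_pdf.
apply: ge0_subset_integral => //.
- apply/measurable_EFinP; apply: measurable_funTS; exact: measurable_gaussian_pdf.
- by move=> y _; rewrite lee_fin gaussian_pdf_ge0.
Qed.

End gaussian_bounds.

Section ou_of_cube.
Context (R : realType) (n : nat) (Q B : 'M[R]_n.+1).
Local Notation mu := (lebesgue_cV R n.+1).
Local Notation E s := (expmx (s *: B)).
Local Notation cube := (box (0 : 'cV[R]_n.+1) 1).
Hypothesis pQ : posdefmx Q.

(** The cube is symmetric about 0, so [e^{tB} x - y] lies in it exactly when [y] lies in its
    translate by [e^{tB} x]. *)
Lemma ou_cubeE t x :
  ou Q B t \1_cube x = fine (gaussian (ou_cov Q B t) (box (E t *m x) 1)).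
Proof.
rewrite /ou /Rintegral; congr fine.
rewrite -[RHS](_ :
  (\int[gaussian (ou_cov Q B t)]_y (\1_(box (E t *m x) 1) y)%:E)%E = _).
  apply: eq_integral => y _; rewrite !indicE; congr (_%:R%:E); congr nat_of_bool.
  apply/idP/idP => /set_mem/boxP h; apply/mem_set/boxP => i.
    by have := h i; rewrite !mxE subr0 distrC.
  by have := h i; rewrite !mxE subr0 distrC.
rewrite integral_indic ?setIT//; exact: measurable_box_center.
Qed.

Lemma sqnorm_box_ge (z y : 'cV[R]_n.+1) : box z 1 y ->
  sqnorm z / 2 - n.+1%:R <= sqnorm y.
Proof.
move=> /boxP zy.
have -> : n.+1%:R = \sum_(i < n.+1) 1 :> R by rewrite sumr_const card_ord.
rewrite /sqnorm mulr_suml -sumrB.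
apply: ler_sum => i _; have : (y i ord0 - z i ord0) ^+ 2 <= 1.
  by rewrite -real_normK ?num_real// expr_le1.
by have := sqr_ge0 (z i ord0 + 2 * (y i ord0 - z i ord0)); nra.
Qed.

Lemma ou_cube_ge0 t x : 0 <= ou Q B t \1_cube x.
Proof. by rewrite ou_cubeE fine_ge0. Qed.

Lemma ou_cube_le s : posdefmx (ou_cov Q B s) ->
  (forall i j, `|E s i j - (i == j)%:R| <= (2 * n.+1%:R)^-1) ->
  forall e, 0 < e -> exists2 r, 0 <= r &
    forall x, r <= sqnorm x -> ou Q B s \1_cube x <= e.
Proof.
move=> pS E1 e e0; set S := ou_cov Q B s.
have [m m0 mS] := posdefmx_coercive (posdefmx_inv pS).
set Z := gaussian_cst S; set b : R := 2 ^+ n.+1.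
have b0 : 0 < b by rewrite exprn_gt0.
have Z0 : 0 <= Z := gaussian_cst_ge0 S.
(* Chosen so that [Z * b * expR (- u) <= e], where [Z * b] is peak density times volume:
   [expR u >= 1 + u] and [e * (1 + u) = e + Z * b]. *)
set u := Z * b / e.
have u0 : 0 <= u by rewrite /u divr_ge0 ?(ltW e0)// mulr_ge0 ?(ltW b0).
(* A threshold for the squared norm. The matrix [e^{sB}] costs a factor 4, passing from the centre
   to a point of the cube a factor 2 and the summand [n.+1]; what remains is
   [sqnorm y >= 2 * u / m]. *)
exists (8 * (2 * u / m + n.+1%:R)).
  by rewrite mulr_ge0// addr_ge0// divr_ge0 ?(ltW m0)// mulr_ge0.
move=> x xr; rewrite ou_cubeE -/S -lee_fin.
have mb := @measurable_box_center R n.+1 (E s *m x) 1.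
have pdfle y : box (E s *m x) 1 y -> gaussian_pdf S y <= Z * expR (- u).
  move=> /sqnorm_box_ge zy; rewrite gaussian_pdfE ?pS.1// ler_wpM2l// ler_expR.
  have h1 := sqnorm_mulmx_ge x E1.
  have h2 : 2 * u / m <= sqnorm y by lra.
  have h3 : 2 * u <= m * sqnorm y by rewrite -ler_pdivrMl// mulrC.
  by have := mS y; lra.
have := gaussian_le mb pdfle; rewrite lebesgue_cV_box_center// => gle.
have gfin : gaussian S (box (E s *m x) 1) \is a fin_num.
  by rewrite ge0_fin_numE//; apply: le_lt_trans gle _; rewrite -EFinM ltry.
rewrite fineK//; apply: le_trans gle _; rewrite -EFinM lee_fin -/b.
rewrite expRN mulrAC ler_pdivrMr ?expR_gt0//.
apply: (@le_trans _ _ (e * (1 + u))); last first.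
  by rewrite ler_wpM2l ?expR_ge1Dx ?(ltW e0).
by rewrite mulrDr /u mulrCA divff ?gt_eqF// mulr1 mulr1 lerDr ltW.
Qed.

Lemma ou_cube_ge K c m s0 : 0 < c -> 0 < m -> 0 < s0 ->
  (forall s, 0 <= s -> forall i j, E s i j ^+ 2 <= K * expR (- c * s)) ->
  (forall t x, s0 <= t -> m * sqnorm x <= qform (ou_cov Q B t) x) ->
  exists2 d, 0 < d & forall M, exists2 t, s0 < t &
    forall x : 'cV[R]_n.+1, (forall i, `|x i ord0| <= M) -> d <= ou Q B t \1_cube x.
Proof.
move=> c0 m0 s00 EK Sm.
set L := `|K| * mx_l1 Q / c.
have L0 : 0 <= L by rewrite divr_ge0 ?mulr_ge0 ?mx_l1_ge0 ?(ltW c0).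
(* Bounds every [det Q_t], [t > 0], by the Leibniz formula; the summand 1 provides [1 <= D] for
   [gaussian_cst_ge]. *)
set D := 1 + n.+1`!%:R * L ^+ n.+1.
have D1 : 1 <= D by rewrite lerDl mulr_ge0 ?exprn_ge0.
(* A lower bound for the density of [gamma_t] where all coordinates are at most 1 in modulus. It is
   also the bound for the mass, since the cube of side 1 used below has volume 1. *)
set d := (2 * pi) `^ (- (n.+1%:R / 2)) * expR (- 2^-1 * ln D) *
         expR (- 2^-1 * (n.+1%:R / m)).
have d0 : 0 < d by rewrite !mulr_gt0 ?expR_gt0 ?powR_gt0 ?mulr_gt0 ?pi_gt0.
exists d => // M.
(* If all entries of [e^{tB}] are at most [a], the coordinates of [e^{tB} x] are at most 1/2, and
   the unit-side cube about 0 lies in the cube of side 2 about [e^{tB} x]. *)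
pose a := (2 * (n.+1%:R * (`|M| + 1)))^-1.
have a0 : 0 < a by rewrite invr_gt0 !mulr_gt0// ltr_wpDl.
have u0 : 0 < (`|K| + 1) / (c * a ^+ 2).
  by rewrite divr_gt0 ?mulr_gt0 ?exprn_gt0// ltr_wpDl.
(* Since [expR (c * t) >= 1 + c * t], the bound [|K| * expR (- c * t) <= a ^+ 2] follows from
   [|K| <= a ^+ 2 * (1 + c * t)]. The extra 1 makes [s0 < t] strict. *)
exists (s0 + (`|K| + 1) / (c * a ^+ 2)); first by rewrite ltrDl.
set t := s0 + _ => x xM.
have st : s0 <= t by rewrite lerDl ltW.
have t0 : 0 < t by exact: lt_le_trans st.
set S := ou_cov Q B t.
have pS : posdefmx S.
  split; first exact: ou_cov_sym.
  by move=> y /sqnorm_gt0 y0; apply: lt_le_trans (Sm t y st); rewrite mulr_gt0.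
have Ea i j : `|E t i j| <= a.
  rewrite -(@ler_pXn2r _ 2) ?qualifE/= ?normr_ge0 ?(ltW a0)// real_normK ?num_real//.
  apply: le_trans (EK t (ltW t0) i j) _.
  apply: le_trans (ler_wpM2r (expR_ge0 _) (ler_norm K)) _.
  rewrite mulNr expRN ler_pdivrMr ?expR_gt0//.
  apply: (@le_trans _ _ (a ^+ 2 * (1 + c * t))); last first.
    by rewrite ler_wpM2l ?sqr_ge0// expR_ge1Dx.
  have -> : a ^+ 2 * (1 + c * t) = a ^+ 2 * (1 + c * s0) + (`|K| + 1).
    by rewrite /t; field; rewrite !gt_eqF.
  have : 0 <= a ^+ 2 * (1 + c * s0).
    by rewrite mulr_ge0 ?sqr_ge0// addr_ge0// ltW// mulr_gt0.
  lra.
have Ex i : `|(E t *m x) i ord0| <= 2^-1.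
  rewrite mxE (le_trans (ler_norm_sum _ _ _))//.
  apply: (@le_trans _ _ (\sum_(j < n.+1) a * (`|M| + 1))).
    apply: ler_sum => j _; rewrite normrM ler_pM//; apply: le_trans (xM j) _.
    by apply: le_trans (ler_norm _) _; rewrite lerDl.
  rewrite sumr_const card_ord -[leLHS]mulr_natl mulrCA /a invfM divfK//.
have sub : box (0 : 'cV[R]_n.+1) 2^-1 `<=` box (E t *m x) 1.
  move=> y /box0P y0; apply/boxP => i; have := y0 i; have := Ex i => h1 h2.
  by apply: le_trans (ler_normB _ _) _; lra.
have pdfge y : box (0 : 'cV[R]_n.+1) 2^-1 y -> d <= gaussian_pdf S y.
  move=> /box0P y0; rewrite gaussian_pdfE ?pS.1//.
  apply: ler_pM; rewrite ?mulr_ge0 ?powR_ge0 ?expR_ge0//.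
    apply: gaussian_cst_ge => //; first exact: posdefmx_unit.
    apply: (@le_trans _ _ (n.+1`!%:R * L ^+ n.+1)); last by rewrite lerDr.
    by apply: det_le => i j; exact: (ou_cov_bounded Q c0 EK t0).
  rewrite ler_expR ler_nM2l ?oppr_lt0 ?invr_gt0//.
  apply: le_trans (qform_inv_le y pS m0 (fun z => Sm t z st)) _.
  rewrite ler_wpM2r ?invr_ge0 ?(ltW m0)//.
  have -> : n.+1%:R = \sum_(i < n.+1) 1 :> R by rewrite sumr_const card_ord.
  apply: ler_sum => i _.
  rewrite -real_normK ?num_real// expr_le1//.
  by apply: le_trans (y0 i) _; lra.
have mb := @measurable_box_center R n.+1 (E t *m x) 1.
have mb' := @measurable_box_center R n.+1 0 2^-1.
have := gaussian_ge mb mb' (ltW d0) sub pdfge.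
rewrite lebesgue_cV_box_center// mulr2n (_ : 2^-1 + 2^-1 = 1); last by field.
rewrite expr1n mule1 ou_cubeE -/S => dg.
rewrite -lee_fin fineK// ge0_fin_numE//.
(* Finiteness of the mass has to be checked because [fine] sends infinity to 0; the density is at
   most its value at the origin. *)
have := @gaussian_le _ _ S _ (gaussian_cst S) mb; rewrite lebesgue_cV_box_center//.
move=> gle; apply: le_lt_trans (gle _) _; last by rewrite -EFinM ltry.
move=> y _; rewrite gaussian_pdfE ?pS.1// ler_piMr ?gaussian_cst_ge0//.
rewrite -expR0 ler_expR mulNr oppr_le0 mulr_ge0//.
have [->|/(posdefmx_qform_gt0 (posdefmx_inv pS))/ltW//] := eqVneq y 0.
by rewrite /qform mulmx0 mxE.
Qed.

End ou_of_cube.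

(** * Unboundedness *)

Section one_jump.
Context (R : realType) (rho c s t : R) (a : R -> R).
Hypotheses (rho1 : 1 <= rho) (c0 : 0 < c) (s0 : 0 < s) (st : s < t).
Hypothesis jump : c <= a t - a s.

Definition two_times (i : nat) : R := if i is 0 then s else t.

Lemma two_times_seq : time_seq 1 two_times.
Proof. by split=> // -[]. Qed.

Let rho0 : 0 < rho. Proof. exact: lt_le_trans rho1. Qed.

Let jump_norm : c <= `|a t - a s|. Proof. exact: le_trans (ler_norm _). Qed.

Lemma maximal_function_ge : 0 <= a s -> (c%:E <= maximal_function a)%E.
Proof.
move=> as0; apply: le_trans (ereal_sup_ubound _); last first.
  by exists t => //=; exact: lt_trans st.
by rewrite lee_fin; apply: le_trans jump _; rewrite gerBl.
Qed.

Lemma variation_seminorm_ge : (c%:E <= variation_seminorm rho a)%E.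
Proof.
apply: le_trans (ereal_sup_ubound _); last first.
  by exists 1%N, two_times; split=> //; exact: two_times_seq.
rewrite lee_fin big_ord1/= -powRrM mulfV ?gt_eqF// powRr1//.
Qed.

(** Jumps are counted by a strict inequality, so the level is [c / 2]; one jump already makes the
    count, and hence its root, at least 1. *)
Lemma jump_count_ge :
  ((c / 2)%:E <= (c / 2)%:E * jump_count (c / 2) a `^ rho^-1)%E.
Proof.
have c2 : 0 < c / 2 by rewrite divr_gt0.
rewrite -[leLHS]mule1 lee_pmul2l// -(poweR1r rho^-1).
apply: gt0_ler_poweR; rewrite ?invr_ge0 ?(ltW rho0) ?in_itv/= ?leey ?andbT//.
- by rewrite /jump_count le_max lexx.
rewrite /jump_count le_max; apply/orP; right; apply: ereal_sup_ubound.
exists 1%N => //; split=> //; exists two_times; first exact: two_times_seq.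
by case=> //= _; apply: lt_le_trans jump_norm; rewrite ltr_pdivrMr// ltr_pMr// ltr1n.
Qed.

Lemma oscillation_ge : (c%:E <= oscillation rho two_times 1 a)%E.
Proof.
rewrite /oscillation big_ord1/=.
have -> : (c%:E = (c `^ rho)%:E `^ rho^-1)%E.
  by rewrite poweR_EFin -powRrM mulfV ?gt_eqF// powRr1// ltW.
have le_sup : ((c `^ rho)%:E <= ereal_sup [set (`|a u - a t| `^ rho)%:E |
    u in [set u | (s <= u <= t)%R]])%E.
  apply: le_trans (ereal_sup_ubound _); last first.
    (* The reference value is the one at the right endpoint [t], so the supremum is tested at the
       left endpoint. *)
    by exists s => //=; rewrite lexx ltW.
  rewrite lee_fin ge0_ler_powR ?nnegrE ?(ltW rho0) ?(ltW c0)//.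
  by rewrite distrC.
apply: gt0_ler_poweR; rewrite ?invr_ge0 ?(ltW rho0) ?in_itv/= ?leey ?andbT//.
- by rewrite lee_fin powR_ge0.
- by apply: le_trans le_sup; rewrite lee_fin powR_ge0.
Qed.

End one_jump.

Section unbounded_operators.
Context (R : realType) (n : nat) (p : R).
Hypothesis p1 : 1 <= p.
Local Notation mu := (lebesgue_cV R n.+1).

Let p0 : 0 < p. Proof. exact: lt_le_trans p1. Qed.

Lemma indic_Lfun (A : set 'cV[R]_n.+1) : measurable A -> (mu A < +oo)%E ->
  \1_A \in Lfun mu p%:E.
Proof.
move=> mA Aoo; rewrite inE/=; apply/andP; split; rewrite inE/=.
  exact: measurable_indic.
rewrite /finite_norm unlock poweR_lty//.
under eq_integral => x _.
  rewrite /= indicE ger0_norm ?ler0n//.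
  rewrite (_ : _ `^ p = \1_A x); last first.
    by rewrite indicE; case: (x \in A); rewrite /= ?powR1 ?powR0 ?gt_eqF.
  over.
by rewrite integral_indic// setIT.
Qed.

(** A bound would make [Phi f] finite, while the region where [g >= c] contains cubes of any volume.
    The function [g] may change with [M], which leaves room for the suprema over levels and time
    sequences inside [Phi]. *)
Lemma not_Lp_bounded (Phi : ('cV[R]_n.+1 -> R) -> \bar R)
    (X : ('cV[R]_n.+1 -> \bar R) -> \bar R) f c r :
  X = @Lp_norm R n.+1 p \/ X = @weak_Lp_norm R n.+1 p ->
  f \in Lfun mu p%:E -> 0 < c -> 0 <= r ->
  (forall M, exists2 g, (X g <= Phi f)%E &
     forall x : 'cV[R]_n.+1, r <= sqnorm x -> (forall i, `|x i ord0| <= M) ->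
       (c%:E <= g x)%E) ->
  ~ Lp_bounded p Phi.
Proof.
move=> XE fL c0 r0 H [C HC].
have : (Phi f < +oo)%E.
  apply: le_lt_trans (HC f fL) _.
  have /andP[_] : f \in Lfun mu p%:E by [].
  rewrite inE/= /finite_norm => fin.
  have : Lp_norm p (EFin \o f) \is a fin_num.
    by rewrite ge0_fin_numE// Lnorm_ge0.
  by move/fineK <-; rewrite -EFinM ltry.
suff : forall L : R, (L%:E <= Phi f)%E.
  case: (Phi f) => [v| |] // HL _; last by have := HL 0.
  by have := HL (v + 1); rewrite lee_fin; lra.
move=> L; pose w := `|L| / (c / 2) + 1.
have w1 : 1 <= w by rewrite lerDr divr_ge0// divr_ge0// ltW.
have w0 : 0 <= w by exact: le_trans w1.
(* The cube has side [w ^ p >= 1], so the [p]-th root of its volume is at least [w] in every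
   dimension [n.+1], and [c / 2 * w >= |L|]. *)
pose y := (w `^ p) / 2.
have y0 : 0 <= y by rewrite divr_ge0 ?powR_ge0.
(* This centre keeps every coordinate at least [1 + r], so that [sqnorm x >= (1 + r) ^+ 2 >= r]. *)
pose a := 1 + r + y.
have [g gPhi gc] := H (a + y).
pose A := box (const_mx a : 'cV[R]_n.+1) y.
have mA : measurable A by exact: measurable_box_center.
have gA x : A x -> (c%:E <= `|g x|)%E.
  move=> /boxP Ax; apply: le_trans (lee_abs _).
  have Axi i : 1 + r <= x i ord0 <= a + y.
    by have := Ax i; rewrite mxE ler_norml /a => /andP[? ?]; apply/andP; split; lra.
  apply: gc => [|i].
    apply: le_trans (sqr_coord_le_sqnorm x ord0).
    have /andP[h _] := Axi ord0; nra.
  by have /andP[? ?] := Axi i; rewrite ger0_norm//; lra.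
apply: le_trans gPhi; apply: le_trans (Lp_weak_Lp_norm_ge p1 c0 mA gA XE).
rewrite lebesgue_cV_box_center// poweR_EFin -EFinM lee_fin.
have wp : y *+ 2 = w `^ p by rewrite mulr2n /y; field.
have wpn : w <= ((y *+ 2) ^+ n.+1) `^ p^-1.
  rewrite -[leLHS](powRr1 w0) -(@mulfV _ p) ?gt_eqF// powRrM -wp.
  have y1 : 1 <= y *+ 2.
    by rewrite wp (le_trans w1)// le1r_powR.
  apply: ge0_ler_powR; rewrite ?nnegrE ?invr_ge0 ?(ltW p0) ?exprn_ge0//.
  - by apply: le_trans y1.
  - by apply: le_trans y1.
  by rewrite exprS ler_peMr ?exprn_ege1// (le_trans _ y1).
apply: le_trans (ler_norm L) _.
have c2 : 0 < c / 2 by rewrite divr_gt0.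
apply: (@le_trans _ _ (c / 2 * w)); last by rewrite ler_wpM2l// ltW.
by rewrite /w mulrDr mulrCA mulfV ?gt_eqF// mulr1 lerDl mulr1 ltW.
Qed.

End unbounded_operators.

Lemma ou_cube_jump (R : realType) (n : nat) (Q B : 'M[R]_n.+1) :
  posdefmx Q ->
  (forall z : R[i], eigenvalue (map_mx (real_complex R) B) z ->
     complex.Re z < 0) ->
  exists c r s, [/\ 0 < c, 0 <= r, 0 < s & forall M, exists2 t, s < t &
    forall x : 'cV[R]_n.+1, r <= sqnorm x -> (forall i, `|x i ord0| <= M) ->
      c <= ou Q B t \1_(box 0 1) x - ou Q B s \1_(box 0 1) x].
Proof.
move=> pQ spB; have [K [b [b0 EK]]] := expmx_decay spB.
have n0 : 0 < (2 * n.+1%:R : R)^-1 by rewrite invr_gt0 mulr_gt0.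
(* This one [s] serves both as the early time of the jump and as the threshold beyond which the
   covariances are uniformly coercive. *)
have [s s0 E1] := expmx_near1 B n0.
have [m m0 Sm] := ou_cov_coercive pQ s0 E1.
have [d d0 Hd] := ou_cube_ge pQ b0 m0 s0 EK Sm.
have pS : posdefmx (ou_cov Q B s).
  split; first exact: ou_cov_sym.
  move=> y /sqnorm_gt0 y0; apply: lt_le_trans (Sm s y (lexx _)).
  by rewrite mulr_gt0.
have Es : 0 <= s <= s by rewrite lexx ltW.
have d20 : 0 < d / 2 by rewrite divr_gt0.
have [r r0 Hr] := ou_cube_le pS (E1 s Es) d20.
exists (d / 2), r, s; split=> // M; have [t st Ht] := Hd M.
exists t => // x xr xM; rewrite lerBrDr; apply: le_trans (Ht x xM).
by rewrite [leRHS]splitr lerD2l; exact: Hr.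
Qed.

Theorem proposition8p1 (R : realType) (n : nat) (Q B : 'M[R]_n) (rho p : R) :
  (1 <= n)%N ->
  posdefmx Q ->
  (forall z : R[i], eigenvalue (map_mx (real_complex R) B) z ->
     complex.Re z < 0) ->
  1 <= rho -> 1 <= p ->
  forall X : ('cV[R]_n -> \bar R) -> \bar R,
  X = @Lp_norm R n p \/ X = @weak_Lp_norm R n p ->
  [/\ ~ Lp_bounded p (fun f =>
          X (fun x => maximal_function (fun t => ou Q B t f x))),
      ~ Lp_bounded p (fun f =>
          X (fun x => variation_seminorm rho (fun t => ou Q B t f x))),
      ~ Lp_bounded p (fun f =>
          ereal_sup [set X (fun x =>
              (lambda%:E * jump_count lambda (fun t => ou Q B t f x)
                             `^ rho^-1)%E)
            | lambda in [set lambda : R | 0 < lambda]]) &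
      ~ Lp_bounded p (fun f =>
          ereal_sup [set ereal_sup [set X (fun x =>
                oscillation rho s N (fun t => ou Q B t f x))
              | s in @time_seq R N]
            | N in [set N : nat | (1 <= N)%N]])].
Proof.
case: n Q B => // n Q B _ pQ spB rho1 p1 X XE.
have [c [r [s [c0 r0 s0 jump]]]] := ou_cube_jump pQ spB.
have cube_fin : (lebesgue_cV R n.+1 (box 0 1) < +oo)%E.
  by rewrite lebesgue_cV_box_center// ltry.
have fL := indic_Lfun p1 (@measurable_box_center R n.+1 0 1) cube_fin.
have unbounded Phi c' := @not_Lp_bounded R n p p1 Phi X \1_(box 0 1) c' r XE fL.
split.
- apply: (unbounded _ c) => // M; have [t st Ht] := jump M.
  eexists; first exact: lexx.
  move=> x xr xM; apply: (maximal_function_ge s0 st (Ht x xr xM)).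
  exact: ou_cube_ge0.
- apply: (unbounded _ c) => // M; have [t st Ht] := jump M.
  eexists; first exact: lexx.
  by move=> x xr xM; apply: (variation_seminorm_ge rho1 s0 st (Ht x xr xM)).
- apply: (unbounded _ (c / 2)) => //; first by rewrite divr_gt0.
  move=> M; have [t st Ht] := jump M.
  eexists; first by apply: ereal_sup_ubound; exists (c / 2); rewrite /= ?divr_gt0.
  by move=> x xr xM; apply: (jump_count_ge rho1 c0 s0 st (Ht x xr xM)).
- apply: (unbounded _ c) => // M; have [t st Ht] := jump M.
  (* Here [g] depends on [M] through the time sequence [s < t]; in the other three cases it is the
     same for all [M]. *)
  exists (fun x => oscillation rho (two_times s t) 1
                     (fun u => ou Q B u \1_(box 0 1) x)).
    apply: ereal_sup_ge; eexists; first by exists 1%N.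
    apply: ereal_sup_ubound; exists (two_times s t) => //.
    exact: two_times_seq.
  by move=> x xr xM; apply: (oscillation_ge rho1 c0 st (Ht x xr xM)).
Qed.
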